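(* Let $s\in(0,1]$, let $I\subset(0,\infty)$ be an interval, let $f:I\to\mathbb{R}$ be differentiable on $I^\circ$, let $a,b\in I$ with $a<b$, and suppose $f'\in L[a,b]$. Let $q\ge 1$. If $|f'|^q$ is harmonically $s$-convex on $[a,b]$, then for all $x\in[a,b]$, $$\left|f(x)-\frac{ab}{b-a}\int_a^b\frac{f(u)}{u^2}\,du\right|\le\frac{ab}{b-a}\Big\{(x-a)^2\big(\lambda_1(a,x,s,q,q)|f'(x)|^q+\lambda_2(a,x,s,q,q)|f'(a)|^q\big)^{1/q}+(b-x)^2\big(\lambda_3(b,x,s,q,q)|f'(x)|^q+\lambda_4(b,x,s,q,q)|f'(b)|^q\big)^{1/q}\Big\}.$$
   Context: For fixed $s\in(0,1]$ and a real interval $J\subset(0,\infty)$, a function $g:J\to\mathbb{R}$ is harmonically $s$-convex if $g\left(\frac{xy}{tx+(1-t)y}\right)\le t^s g(y)+(1-t)^s g(x)$ for all $x,y\in J$ and $t\in[0,1]$. $I^\circ$ is the interior of $I$; $L[a,b]$ denotes the Lebesgue integrable functions on $[a,b]$. Since $f'$ is used on all of $[a,b]$, $f$ is understood to be differentiable at every point of $[a,b]$ (one-sided at a point of $[a,b]$ that is an endpoint of $I$). The functions $\lambda_i$ are defined for $0<a\le x$ (for $\lambda_1,\lambda_2$) and $0<x\le b$ (for $\lambda_3,\lambda_4$) by $$\lambda_1(a,x,s,\vartheta,\rho)=\frac{\beta(\rho+s+1,1)}{x^{2\vartheta}}\,{}_2F_1\left(2\vartheta,\rho+s+1;\rho+s+2;1-\frac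 ax\right),$$ $$\lambda_2(a,x,s,\vartheta,\rho)=\frac{\beta(\rho+1,s+1)}{x^{2\vartheta}}\,{}_2F_1\left(2\vartheta,\rho+1;\rho+s+2;1-\frac ax\right),$$ $$\lambda_3(b,x,s,\vartheta,\rho)=\frac{\beta(1,\rho+s+1)}{b^{2\vartheta}}\,{}_2F_1\left(2\vartheta,1;\rho+s+2;1-\frac xb\right),$$ $$\lambda_4(b,x,s,\vartheta,\rho)=\frac{\beta(s+1,\rho+1)}{b^{2\vartheta}}\,{}_2F_1\left(2\vartheta,s+1;\rho+s+2;1-\frac xb\right).$$ Here $\beta(u,v)=\int_0^1t^{u-1}(1-t)^{v-1}\,dt$ for $u,v>0$ is the Euler Beta function, and ${}_2F_1(\alpha,\gamma;c;z)=\frac{1}{\beta(\gamma,c-\gamma)}\int_0^1t^{\gamma-1}(1-t)^{c-\gamma-1}(1-zt)^{-\alpha}\,dt$ for $c>\gamma>0$, $|z|<1$, is the hypergeometric function. *)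

(* Defs.v *)
From mathcomp Require Import all_boot all_order all_algebra.
From mathcomp Require Import all_classical all_reals all_analysis.
Set Implicit Arguments.
Unset Strict Implicit.
Unset Printing Implicit Defensive.
Import Order.TTheory GRing.Theory Num.Theory.
Import numFieldTopology.Exports numFieldNormedType.Exports.
Local Open Scope classical_set_scope.
Local Open Scope ring_scope.

(* Differentiability at x of f regarded as a function on A: increments are
   restricted to those staying in A, so the derivative is one-sided when x is
   an endpoint of an interval A, and values of f outside A are irrelevant. *)
Definition derivable_within (R : realType) (A : set R) (f : R -> R) (x : R) :=
  cvg ((fun h => h^-1 * (f (h + x) - f x)) @ within [set h | A (h + x)] 0^').

Definition derive_within (R : realType) (A : set R) (f : R -> R) (x : R) : R :=
  lim ((fun h => h^-1 * (f (h + x) - f x)) @ within [set h | A (h + x)] 0^').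

Lemma within_shift_interior (R : realType) (A : set R) (x : R) :
  A° x -> within [set h : R | A (h + x)] 0^' = 0^' :> set_system R.
Proof.
move=> Ax; apply/seteqP; split => B; rewrite /within /= => B0; last first.
  by apply: filterS B0 => h.
have A0 : \forall h \near (0 : R)^', A (h + x).
  apply: nbhs_dnbhs; have c : (fun h : R => h + x) @ (0 : R) --> x.
    by rewrite -[X in _ --> X]add0r; apply: cvgD; [exact: cvg_id|exact: cvg_cst].
  exact: c Ax.
by apply: filterS2 A0 B0 => h /[swap]; apply.
Qed.

Lemma derivable_within_interior (R : realType) (A : set R) (f : R -> R) (x : R) :
  A° x -> derivable_within A f x <-> derivable f x 1.
Proof.
move=> Ax; rewrite /derivable_within within_shift_interior// /derivable.
by under [X in _ <-> cvg (X @ _)]eq_fun do rewrite /GRing.scale /= mulr1.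
Qed.

Lemma derive_within_interior (R : realType) (A : set R) (f : R -> R) (x : R) :
  A° x -> derive_within A f x = derive1 f x.
Proof. by move=> Ax; rewrite /derive_within within_shift_interior. Qed.

(* 0 `^ s = 0 for s != 0, so t = 0 and t = 1 give the intended values. *)
Definition harmonically_s_convex (R : realType) (s : R) (J : set R)
    (g : R -> R) :=
  forall x y t : R, J x -> J y -> 0 <= t <= 1 ->
    g (x * y / (t * x + (1 - t) * y)) <= t `^ s * g y + (1 - t) `^ s * g x.

(* Euler Beta function for u, v > 0; the value of `^ at base 0 affects only
   the endpoints, a null set. *)
Definition Beta (R : realType) (u v : R) : R :=
  \int[@lebesgue_measure R]_(t in `[0, 1])
    (t `^ (u - 1) * (1 - t) `^ (v - 1)).

(* 2F1(alpha, gamma; c; z) for c > gamma > 0 and |z| < 1, by Euler's integral. *)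
Definition hyp2F1 (R : realType) (alpha gamma c z : R) : R :=
  (Beta gamma (c - gamma))^-1 *
  \int[@lebesgue_measure R]_(t in `[0, 1])
    (t `^ (gamma - 1) * (1 - t) `^ (c - gamma - 1) * (1 - z * t) `^ (- alpha)).

Definition lambda1 (R : realType) (a x s theta rho : R) : R :=
  Beta (rho + s + 1) 1 / x `^ (2 * theta) *
  hyp2F1 (2 * theta) (rho + s + 1) (rho + s + 2) (1 - a / x).

Definition lambda2 (R : realType) (a x s theta rho : R) : R :=
  Beta (rho + 1) (s + 1) / x `^ (2 * theta) *
  hyp2F1 (2 * theta) (rho + 1) (rho + s + 2) (1 - a / x).

Definition lambda3 (R : realType) (b x s theta rho : R) : R :=
  Beta 1 (rho + s + 1) / b `^ (2 * theta) *
  hyp2F1 (2 * theta) 1 (rho + s + 2) (1 - x / b).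

Definition lambda4 (R : realType) (b x s theta rho : R) : R :=
  Beta (s + 1) (rho + 1) / b `^ (2 * theta) *
  hyp2F1 (2 * theta) (s + 1) (rho + s + 2) (1 - x / b).

(* Main.v *)
(* Up to the factor ab/(b-a), the left-hand side is F(b) - F(a) for a primitive F
   of (f(x) - f(u))/u^2, and it splits into F(x) - F(a) and F(x) - F(b).  For an
   endpoint e the function G(u) = F(u) - (f(x) - f(u))(1/e - 1/u) has the same
   increment from e to x as F, and G'(u) = f'(u)(1/e - 1/u).  Along the curve
   u = ex/(te + (1-t)x), t in [0,1], the derivative of G becomes
   (x-e)^2 t (te + (1-t)x)^-2 f'(u), where harmonic s-convexity bounds |f'(u)| by
   the continuous function (t^s |f'(x)|^q + (1-t)^s |f'(e)|^q)^(1/q).  Comparing G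
   with a primitive of this continuous bound needs only the mean value theorem, so
   that f' is never integrated.  Jensen's inequality on [0,1] then gives the two
   terms of the right-hand side, the Beta factors in the lambdas cancelling
   against those in Euler's integral. *)
Require Import Defs.
From mathcomp Require Import all_boot all_order all_algebra.
From mathcomp Require Import all_classical all_reals all_analysis.
From mathcomp Require Import ring lra.
Import Order.TTheory GRing.Theory Num.Theory.
Import numFieldTopology.Exports numFieldNormedType.Exports.
Local Open Scope classical_set_scope.
Local Open Scope ring_scope.
Set Implicit Arguments.
Unset Strict Implicit.
Unset Printing Implicit Defensive.

(** * Continuity relative to a subset *)

Section WithinContinuity.
Context {R : realType} {T : topologicalType}.
Implicit Types (A : set T) (f g : T -> R).

(** Continuity of [g] relative to [B] is what is available later: for the power function at the end
    [0] of the half-line, and for functions on [[a, b]] composed with a curve into [[a, b]]. *)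
Lemma within_continuous_comp_sub A (B : set R) f (g : R -> R) :
  {within A, continuous f} -> {within B, continuous g} ->
  (forall x, A x -> B (f x)) -> {within A, continuous (fun x => g (f x))}.
Proof.
move=> /subspace_continuousP cf /subspace_continuousP cg AB.
apply/subspace_continuousP => x Ax.
apply: cvg_comp (cg _ (AB _ Ax)) => P BP.
have := cf x Ax _ BP; rewrite /nbhs /= /within /=; apply: filterS => y fy Ay.
exact: fy Ay (AB y Ay).
Qed.

Lemma within_continuous_cst A (c : R) : {within A, continuous (fun _ : T => c)}.
Proof. by apply: continuous_subspaceT => x; exact: cvg_cst. Qed.

Lemma within_continuousM A f g :
  {within A, continuous f} -> {within A, continuous g} ->
  {within A, continuous (fun x => f x * g x)}.
Proof. by move=> cf cg x; apply: cvgM; [exact: cf|exact: cg]. Qed.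

Lemma within_continuous_add A f g :
  {within A, continuous f} -> {within A, continuous g} ->
  {within A, continuous (fun x => f x + g x)}.
Proof. by move=> cf cg x; apply: cvgD; [exact: cf|exact: cg]. Qed.

Lemma within_continuous_sub A f g :
  {within A, continuous f} -> {within A, continuous g} ->
  {within A, continuous (fun x => f x - g x)}.
Proof. by move=> cf cg x; apply: cvgB; [exact: cf|exact: cg]. Qed.

Lemma within_continuousV A f : {within A, continuous f} ->
  (forall x, A x -> f x != 0) -> {within A, continuous (fun x => (f x)^-1)}.
Proof.
move=> cf f0; apply: (@within_continuous_comp _ _ _ _ f GRing.inv) => //.
by move=> _ /[!inE] -[x Ax <-]; apply: inv_continuous; exact: f0.
Qed.

(** Here [f] may vanish. For [p = 0] the power is constantly [1], even at base [0]; for [p > 0] it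
    tends to [0] at the base [0] from the right, which is its value there. *)
Lemma within_continuous_powR A f (p : R) : 0 <= p -> {within A, continuous f} ->
  (forall x, A x -> 0 <= f x) -> {within A, continuous (fun x => f x `^ p)}.
Proof.
rewrite le_eqVlt => /predU1P[<- _ _|p0 cf f0].
  by under eq_fun do rewrite powRr0; exact: within_continuous_cst.
apply: (@within_continuous_comp_sub _ `[0, +oo[%classic f (@powR R ^~ p)) => //; last first.
  by move=> x /f0; rewrite /= in_itv/= andbT.
apply/continuous_within_itvcyP; split.
  move=> x x0; apply/differentiable_continuous/derivable1_diffP.
  exact: derivable_powR.
by rewrite powR0 ?gt_eqF//; exact: powR_cvg0.
Qed.

Lemma within_continuous_powR_gt0 A f (p : R) : {within A, continuous f} ->
  (forall x, A x -> 0 < f x) -> {within A, continuous (fun x => f x `^ p)}.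
Proof.
move=> cf f0; apply: (@within_continuous_comp _ _ _ _ f (@powR R ^~ p)) => //.
move=> _ /[!inE] -[x /f0 fx <-].
apply/differentiable_continuous/derivable1_diffP/derivable_powR.
by rewrite in_itv/= andbT.
Qed.

End WithinContinuity.

(** * Integrals of continuous functions, mean value comparison and Jensen's inequality *)

Section ContinuousIntegrals.
Context {R : realType}.
Notation mu := (@lebesgue_measure R).
Implicit Types (a b : R) (f g : R -> R).

Lemma within_continuous_integrable a b f : {within `[a, b], continuous f} ->
  mu.-integrable `[a, b] (EFin \o f).
Proof.
by move=> cf; apply: continuous_compact_integrable => //; exact: segment_compact.
Qed.

Lemma is_derive_Rintegral a b f x : {within `[a, b], continuous f} ->
  x \in `]a, b[ -> is_derive x 1 (fun y => \int[mu]_(t in `[a, y]) f t) (f x).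
Proof.
move=> cf xab; have /andP[ax xb] : a < x < b by rewrite in_itv /= in xab.
have ab := lt_trans ax xb.
have [dF F'] := @continuous_FTC1_closed _ f a x b xb
  (within_continuous_integrable cf) ax
  (within_continuous_continuous ab cf xab).
by split; [exact: dF|rewrite -derive1E].
Qed.

Lemma within_continuous_Rintegral a b f : a <= b -> {within `[a, b], continuous f} ->
  {within `[a, b], continuous (fun y => \int[mu]_(t in `[a, y]) f t)}.
Proof.
move=> ab cf; apply: parameterized_integral_continuous => //.
exact: within_continuous_integrable.
Qed.

(** The mean value theorem for the primitive writes the integral as [f x * (b - a)] with [x]
    interior, so [f] may vanish at the ends, as Beta densities do. *)
Lemma Rintegral_gt0 a b f : a < b -> {within `[a, b], continuous f} ->
  (forall x, x \in `]a, b[ -> 0 < f x) -> 0 < \int[mu]_(t in `[a, b]) f t.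
Proof.
move=> ab cf f0.
have [x xab] := MVT ab (fun x => is_derive_Rintegral cf)
  (within_continuous_Rintegral (ltW ab) cf).
rewrite set_itv1 Rintegral_set1 subr0 => ->.
by rewrite mulr_gt0 ?subr_gt0// f0.
Qed.

(** With [G] the primitive of [g], both [G + f] and [G - f] have nonnegative derivative, hence
    nonnegative increment by the mean value theorem. Only [g] is integrated, never [df]. *)
Lemma norm_increment_le a b f g (df : R -> R) : a < b ->
  {within `[a, b], continuous f} -> {within `[a, b], continuous g} ->
  (forall x, x \in `]a, b[ -> is_derive x 1 f (df x)) ->
  (forall x, x \in `]a, b[ -> `|df x| <= g x) ->
  `|f b - f a| <= \int[mu]_(t in `[a, b]) g t.
Proof.
move=> ab cf cg f' fg; set G := fun y => \int[mu]_(t in `[a, y]) g t.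
have cG := within_continuous_Rintegral (ltW ab) cg.
have G' x (xab : x \in `]a, b[) := is_derive_Rintegral cg xab.
have Ga : G a = 0 by rewrite /G set_itv1 Rintegral_set1.
rewrite -[leRHS]subr0 -[in leRHS]Ga ler_norml; apply/andP; split.
- have [x xab] := MVT ab (fun x xab => is_deriveD (G' x xab) (f' x xab))
    (within_continuousD cG cf).
  rewrite !fctE -/(G a) -/(G b) => e.
  have : 0 <= (g x + df x) * (b - a).
    rewrite mulr_ge0 ?subr_ge0 ?(ltW ab)//.
    by have := fg x xab; rewrite ler_norml => /andP[]; lra.
  by rewrite -e; lra.
- have [x xab] := MVT ab (fun x xab => is_deriveB (G' x xab) (f' x xab))
    (within_continuousB cG cf).
  rewrite !fctE -/(G a) -/(G b) => e.
  have : 0 <= (g x - df x) * (b - a).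
    rewrite mulr_ge0 ?subr_ge0 ?(ltW ab)//.
    by have := fg x xab; rewrite ler_norml => /andP[]; lra.
  by rewrite -e; lra.
Qed.

(* Young's inequality for the pair [y], [1]. *)
Lemma bernoulli_powR (y q : R) : 0 <= y -> 1 <= q -> 1 + q * (y - 1) <= y `^ q.
Proof.
(* At [q = 1] equality holds; this case is set apart because the conjugate exponent would be
   infinite. *)
move=> y0; rewrite le_eqVlt => /predU1P[<-|q1].
  by rewrite powRr1// mul1r addrC subrK.
have q0 : 0 < q by apply: lt_trans q1.
have p0 : 0 < 1 - q^-1 by rewrite subr_gt0 invf_lt1.
have := @conjugate_powR _ y 1 q (1 - q^-1)^-1 y0 ler01 q0.
rewrite invr_gt0 => /(_ p0); rewrite invrK powR1 /= mulr1 mul1r.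
rewrite addrC subrK => /(_ erefl).
rewrite -(ler_pM2l q0) mulrDr mulrCA mulfV ?gt_eqF// mulr1 mulrBr mulr1.
by rewrite mulfV ?gt_eqF//; lra.
Qed.

(** Jensen's inequality on a space of mass [1], from the tangent line of the power at the mean [m].
    The case [m = 0] is trivial and is separated because the argument divides by [m]. *)
Lemma Rintegral_le_powR f (q : R) : 1 <= q -> {within `[0, 1], continuous f} ->
  (forall x, x \in `[0, 1] -> 0 <= f x) ->
  \int[mu]_(t in `[0, 1]) f t <= (\int[mu]_(t in `[0, 1]) f t `^ q) `^ (1 / q).
Proof.
move=> q1 cf f0; set m := Rintegral _ _ _.
have q0 : 0 < q by apply: lt_le_trans q1.
have : 0 <= m by apply: Rintegral_ge0 => x x01; exact: f0.
rewrite le_eqVlt => /predU1P[<-|m0]; first exact: powR_ge0.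
have cfq : {within `[0, 1], continuous (fun t => f t `^ q)}.
  by apply: within_continuous_powR => //; exact: ltW.
have -> : m = (m `^ q) `^ (1 / q).
  by rewrite -powRrM mul1r mulfV ?gt_eqF// powRr1// ltW.
(* Bernoulli at [f t / m], integrated: the linear term vanishes. *)
have ge : m `^ q <= \int[mu]_(t in `[0, 1]) f t `^ q.
  have -> : m `^ q =
      \int[mu]_(t in `[0, 1]) (m `^ q * (1 - q) + m `^ q * q / m * f t).
    rewrite RintegralD//=; last 2 first.
    - exact/within_continuous_integrable/within_continuous_cst.
    - apply/within_continuous_integrable/within_continuousM => //.
      exact: within_continuous_cst.
    rewrite Rintegral_cst//= lebesgue_measure_itv/= lte01 oppr0 addr0 mulr1.
    rewrite RintegralZl//=; last exact: within_continuous_integrable.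
    by rewrite -/m divfK ?gt_eqF//; ring.
  apply: le_Rintegral => //=.
  - apply/within_continuous_integrable/within_continuous_add.
      exact: within_continuous_cst.
    by apply: within_continuousM => //; exact: within_continuous_cst.
  - exact: within_continuous_integrable.
  move=> t t01; have ft := f0 t t01.
  have -> : f t `^ q = m `^ q * (f t / m) `^ q.
    by rewrite -powRM ?divr_ge0 ?(ltW m0)// mulrCA mulfV ?gt_eqF// mulr1.
  have := bernoulli_powR (divr_ge0 ft (ltW m0)) q1.
  rewrite -(ler_pM2l (powR_gt0 q m0)); apply: le_trans.
  by rewrite le_eqVlt; apply/orP; left; apply/eqP; ring.
by apply: ge0_ler_powR => //; rewrite ?nnegrE ?divr_ge0 ?powR_ge0// ltW//;
  exact: lt_le_trans (powR_gt0 _ m0) ge.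
Qed.

End ContinuousIntegrals.

(** * Euler integrals, their relation to the lambdas, and the integrated convexity bound *)

Section EulerIntegrals.
Context {R : realType}.
Notation mu := (@lebesgue_measure R).
Implicit Types (e p r s t u v x z : R).

(** Euler's integral for the hypergeometric function in homogeneous form: since [t * e + (1 - t) * x
    = x * (1 - (1 - e / x) * t)], the prefactor [x ^ (- alpha)] is absorbed. The exponents [p] and
    [r] are the Beta parameters minus one. *)
Definition euler_integral p r alpha e x : R :=
  \int[mu]_(t in `[0, 1])
    (t `^ p * (1 - t) `^ r * (t * e + (1 - t) * x) `^ (- alpha)).

Lemma within_continuous_idfun (A : set R) : {within A, continuous (fun x => x)}.
Proof. by apply: continuous_subspaceT => x; exact: cvg_id. Qed.

Lemma within_continuous_onem (A : set R) : {within A, continuous (fun x => 1 - x)}.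
Proof.
apply: within_continuous_sub; first exact: within_continuous_cst.
exact: within_continuous_idfun.
Qed.

Lemma within_continuous_mean (A : set R) e x :
  {within A, continuous (fun t => t * e + (1 - t) * x)}.
Proof.
apply: within_continuous_add; apply: within_continuousM;
  [exact: within_continuous_idfun|exact: within_continuous_cst
  |exact: within_continuous_onem|exact: within_continuous_cst].
Qed.

Lemma mean_gt0 e x t : 0 < e -> 0 < x -> 0 <= t <= 1 -> 0 < t * e + (1 - t) * x.
Proof.
move=> e0 x0 /andP[t0 t1]; move: t0; rewrite le_eqVlt => /predU1P[<-|t0].
  by rewrite mul0r add0r subr0 mul1r.
by rewrite ltr_pwDl ?mulr_gt0// mulr_ge0 ?subr_ge0// ltW.
Qed.

Lemma within_continuous_beta_density p r : 0 <= p -> 0 <= r ->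
  {within `[0, 1], continuous (fun t => t `^ p * (1 - t) `^ r)}.
Proof.
move=> p0 r0; apply: within_continuousM; apply: within_continuous_powR => //.
- exact: within_continuous_idfun.
- by move=> t; rewrite /= in_itv/= => /andP[].
- exact: within_continuous_onem.
- by move=> t; rewrite /= in_itv/= subr_ge0 => /andP[].
Qed.

Lemma within_continuous_euler p r alpha e x : 0 <= p -> 0 <= r -> 0 < e -> 0 < x ->
  {within `[0, 1], continuous (fun t =>
    t `^ p * (1 - t) `^ r * (t * e + (1 - t) * x) `^ (- alpha))}.
Proof.
move=> p0 r0 e0 x0; apply: within_continuousM.
  exact: within_continuous_beta_density.
apply: within_continuous_powR_gt0; first exact: within_continuous_mean.
by move=> t; rewrite /= in_itv/=; exact: mean_gt0.
Qed.

Lemma euler_integralC p r alpha e x : 0 <= p -> 0 <= r -> 0 < e -> 0 < x ->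
  euler_integral p r alpha e x = euler_integral r p alpha x e.
Proof.
move=> p0 r0 e0 x0; have h01 : 0 <= (1 : R) <= 1 by rewrite ler01 lexx.
(* The substitution [t -> 1 - t] exchanges the two ends and the two exponents; the bound [1 - 1] is
   the shape in which it yields the image interval. *)
have -> : euler_integral p r alpha e x = \int[mu]_(t in `[1 - 1, 1])
    ((1 - t) `^ p * (1 - (1 - t)) `^ r *
     ((1 - t) * e + (1 - (1 - t)) * x) `^ (- alpha)).
  rewrite /euler_integral.
  exact: (Rintegration_by_substitution_onem h01
    (within_continuous_euler (alpha := alpha) p0 r0 e0 x0)).
rewrite subrr; apply: eq_Rintegral => t _.
by rewrite subKr [_ * e + _]addrC [_ `^ p * _]mulrC.
Qed.

Lemma Beta_gt0 u v : 1 <= u -> 1 <= v -> 0 < Beta u v.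
Proof.
move=> u1 v1; apply: Rintegral_gt0 => //.
  by apply: within_continuous_beta_density; rewrite subr_ge0.
by move=> t; rewrite in_itv/= => /andP[t0 t1]; rewrite mulr_gt0 ?powR_gt0 ?subr_gt0.
Qed.

(** The Beta factor cancels the normalisation of [hyp2F1], and the power of [x] merges with the
    kernel. The parameter [c] is kept apart from [u + v] to match the form [rho + s + 2] in the
    lambdas. *)
Lemma Beta_hyp2F1E u v c alpha e x : 1 <= u -> 1 <= v -> 0 < e -> 0 < x ->
  c = u + v ->
  Beta u v / x `^ alpha * hyp2F1 alpha u c (1 - e / x) =
  euler_integral (u - 1) (v - 1) alpha e x.
Proof.
move=> u1 v1 e0 x0 ->; rewrite /hyp2F1 addrAC subrr add0r.
rewrite mulrA [_ / _ / _]mulrAC mulfV ?gt_eqF ?Beta_gt0// mul1r.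
rewrite mulrC -RintegralZr /=; [|by []|].
  apply: eq_Rintegral => t; rewrite inE/= in_itv/= => t01.
  have m0 := mean_gt0 e0 x0 t01.
  rewrite -[in LHS]mulrA -powRN -powRM ?(ltW x0)//.
    congr (_ * _ `^ _).
    by field; rewrite gt_eqF.
  rewrite (_ : _ - _ = (t * e + (1 - t) * x) / x) ?divr_ge0 ?ltW//.
  by field; rewrite gt_eqF.
apply: within_continuous_integrable.
(* The kernel [1 - z * t] is itself a weighted mean, of [e / x] and [1]. *)
rewrite (_ : (fun t => _) = (fun t => t `^ (u - 1) * (1 - t) `^ (v - 1) *
    (t * (e / x) + (1 - t) * 1) `^ (- alpha))).
  by apply: within_continuous_euler; rewrite ?subr_ge0// divr_gt0.
by apply/funext => t; congr (_ * _ `^ _); ring.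
Qed.

Lemma lambda1E e x s theta p : 0 < e -> 0 < x -> 0 <= s -> 0 <= p ->
  lambda1 e x s theta p = euler_integral (p + s) 0 (2 * theta) e x.
Proof.
move=> e0 x0 s0 p0.
have hps : 1 <= p + s + 1 by rewrite lerDr addr_ge0.
have hc : p + s + 2 = p + s + 1 + 1 by ring.
rewrite /lambda1 (Beta_hyp2F1E _ hps (lexx 1) e0 x0 hc).
by rewrite addrK subrr.
Qed.

Lemma lambda2E e x s theta p : 0 < e -> 0 < x -> 0 <= s -> 0 <= p ->
  lambda2 e x s theta p = euler_integral p s (2 * theta) e x.
Proof.
move=> e0 x0 s0 p0.
have hp : 1 <= p + 1 by rewrite lerDr.
have hs : 1 <= s + 1 by rewrite lerDr.
have hc : p + s + 2 = p + 1 + (s + 1) by ring.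
rewrite /lambda2 (Beta_hyp2F1E _ hp hs e0 x0 hc).
by rewrite !addrK.
Qed.

(** Here the hypergeometric argument is [1 - x / e], so [e] and [x] exchange roles; reflecting [t]
    gives the same Euler integral as for [lambda1]. Hence the two ends can be treated alike. *)
Lemma lambda3E e x s theta p : 0 < e -> 0 < x -> 0 <= s -> 0 <= p ->
  lambda3 e x s theta p = euler_integral (p + s) 0 (2 * theta) e x.
Proof.
move=> e0 x0 s0 p0.
have hps : 1 <= p + s + 1 by rewrite lerDr addr_ge0.
have hc : p + s + 2 = 1 + (p + s + 1) by ring.
rewrite /lambda3 (Beta_hyp2F1E _ (lexx 1) hps x0 e0 hc).
by rewrite addrK subrr euler_integralC ?addr_ge0.
Qed.

Lemma lambda4E e x s theta p : 0 < e -> 0 < x -> 0 <= s -> 0 <= p ->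
  lambda4 e x s theta p = euler_integral p s (2 * theta) e x.
Proof.
move=> e0 x0 s0 p0.
have hp : 1 <= p + 1 by rewrite lerDr.
have hs : 1 <= s + 1 by rewrite lerDr.
have hc : p + s + 2 = s + 1 + (p + 1) by ring.
rewrite /lambda4 (Beta_hyp2F1E _ hs hp x0 e0 hc).
by rewrite !addrK euler_integralC.
Qed.

(* The harmonic s-convexity bound on [|f'|] at the parameter [t], where [A] and
   [B] stand for the values of [|f'| ^ q] at the two ends. *)
Definition convex_bound s q A B t : R := (t `^ s * A + (1 - t) `^ s * B) `^ (1 / q).

Lemma within_continuous_convex_bound s q A B : 0 <= s -> 0 < q -> 0 <= A -> 0 <= B ->
  {within `[0, 1], continuous (convex_bound s q A B)}.
Proof.
move=> s0 q0 A0 B0; apply: within_continuous_powR.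
- by rewrite divr_ge0// ltW.
- apply: within_continuous_add; apply: within_continuousM;
    try exact: within_continuous_cst; apply: within_continuous_powR => //.
  + exact: within_continuous_idfun.
  + by move=> t; rewrite /= in_itv/= => /andP[].
  + exact: within_continuous_onem.
  + by move=> t; rewrite /= in_itv/= subr_ge0 => /andP[].
- by move=> t _; rewrite addr_ge0// mulr_ge0 ?powR_ge0.
Qed.

(** After Jensen, the [q]-th power of the integrand is [t ^ q] times the mean to the power [- 2 * q]
    times [t ^ s * A + (1 - t) ^ s * B], a sum of two Euler densities. *)
Lemma Rintegral_convex_bound_le s q A B e x :
  0 <= s -> 1 <= q -> 0 <= A -> 0 <= B -> 0 < e -> 0 < x ->
  \int[mu]_(t in `[0, 1])
    (t * (t * e + (1 - t) * x) `^ (- 2) * convex_bound s q A B t) <=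
  (euler_integral (q + s) 0 (2 * q) e x * A +
   euler_integral q s (2 * q) e x * B) `^ (1 / q).
Proof.
move=> s0 q1 A0 B0 e0 x0; have q0 : 0 < q by apply: lt_le_trans q1.
set phi := (X in Rintegral _ _ X); apply: (@le_trans _ _ _ _ _ (Rintegral_le_powR (f := phi) q1 _ _)).
- apply: within_continuousM; last exact: within_continuous_convex_bound.
  apply: within_continuousM; first exact: within_continuous_idfun.
  apply: within_continuous_powR_gt0; first exact: within_continuous_mean.
  by move=> t; rewrite /= in_itv/=; exact: mean_gt0.
- by move=> t; rewrite in_itv/= => /andP[t0 _]; rewrite !mulr_ge0 ?powR_ge0.
rewrite le_eqVlt; apply/orP; left; apply/eqP; congr (_ `^ _).
have q0' := ltW q0; have qs0 := addr_ge0 q0' s0.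
have c1 := within_continuous_euler (alpha := 2 * q) qs0 (lexx 0) e0 x0.
have c2 := within_continuous_euler (alpha := 2 * q) q0' s0 e0 x0.
rewrite /euler_integral -RintegralZr //=; last exact: within_continuous_integrable.
rewrite -RintegralZr //=; last exact: within_continuous_integrable.
rewrite -RintegralD //=; last 2 first.
- apply/within_continuous_integrable/(within_continuousM c1).
  exact: within_continuous_cst.
- apply/within_continuous_integrable/(within_continuousM c2).
  exact: within_continuous_cst.
apply: eq_Rintegral => t; rewrite inE/= in_itv/= => t01.
have /andP[t0 t1] := t01.
rewrite /phi /convex_bound !powRM ?mulr_ge0 ?powR_ge0// -!powRrM.
rewrite mul1r mulVf ?gt_eqF// powRr1; last first.
  by rewrite addr_ge0// mulr_ge0 ?powR_ge0.
(* The factor with exponent [0] is [1] even at [t = 1], and the powers of [t] merge even at [t = 0]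
   because [q + s] is nonzero. *)
rewrite powRr0 mulr1 powRD; last by rewrite gt_eqF// ltr_wpDr.
by rewrite mulNr; ring.
Qed.

End EulerIntegrals.

(** * Comparison of increments along the harmonic curve *)

Section Ostrowski.
Context {R : realType}.
Notation mu := (@lebesgue_measure R).
Implicit Types (f F df h : R -> R) (a b e x : R).

(** Weighted harmonic mean, with reciprocal [t / x + (1 - t) / e]: it runs from [e] at [t = 0] to
    [x] at [t = 1]. *)
Definition hmean e x t : R := e * x / (t * e + (1 - t) * x).

Lemma hmean_itv e x t : 0 < e -> 0 < x -> e < x -> t \in `]0, 1[ ->
  hmean e x t \in `]e, x[.
Proof.
move=> e0 x0 ex; rewrite !in_itv/= => /andP[t0 t1].
have D0 : 0 < t * e + (1 - t) * x by apply: mean_gt0; rewrite ?ltW.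
rewrite /hmean ltr_pdivlMr// ltr_pdivrMr// ltr_pM2l// [e * x]mulrC ltr_pM2l//.
have d0 : 0 < x - e by rewrite subr_gt0.
have t1' : 0 < 1 - t by rewrite subr_gt0.
have := mulr_gt0 t0 d0; have := mulr_gt0 t1' d0.
by move=> h1 h2; apply/andP; split; lra.
Qed.

Lemma hmeanC e x t : hmean e x t = hmean x e (1 - t).
Proof. by rewrite /hmean subKr [e * x]mulrC [_ * e + _]addrC. Qed.

Lemma hmean0 e x : x != 0 -> hmean e x 0 = e.
Proof. by move=> x0; rewrite /hmean mul0r add0r subr0 mul1r mulfK. Qed.

Lemma hmean1 e x : e != 0 -> hmean e x 1 = x.
Proof. by move=> e0; rewrite hmeanC subrr hmean0. Qed.

Lemma is_derive_hmean e x t : t * e + (1 - t) * x != 0 ->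
  is_derive t 1 (hmean e x)
    (e * x * (x - e) / (t * e + (1 - t) * x) ^+ 2).
Proof.
move=> D0.
have dD : is_derive t 1 (fun t => t * e + (1 - t) * x) (e - x).
  have dL := is_deriveM (is_derive_id t (1 : R)) (is_derive_cst e t (1 : R)).
  have dR := is_deriveM (is_deriveB (is_derive_cst (1 : R) t (1 : R))
    (is_derive_id t (1 : R))) (is_derive_cst x t (1 : R)).
  apply: (is_derive_eq (is_deriveD dL dR)).
  by rewrite /GRing.scale !fctE /=; ring.
have dV := @is_deriveV R (fun t => t * e + (1 - t) * x) t (e - x) 1 D0 dD.
rewrite (_ : hmean e x = (e * x) \*: (fun t => (t * e + (1 - t) * x)^-1)) //.
apply: (is_derive_eq (is_deriveZ (e * x) dV)).
by rewrite /GRing.scale /=; field.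
Qed.

(** Either order of [e] and [x] is allowed, so that both ends are served. For [t] in []0, 1[] the
    curve stays in []a, b[], where derivatives are two-sided; at [a] and [b] continuity suffices. *)
Lemma derive_bound_increment a b e x f F df h : 0 < a -> a < b ->
  e \in `[a, b] -> x \in `[a, b] ->
  {within `[a, b], continuous f} -> {within `[a, b], continuous F} ->
  (forall u, u \in `]a, b[ -> is_derive u 1 f (df u)) ->
  (forall u, u \in `]a, b[ -> is_derive u 1 F ((f x - f u) / u ^+ 2)) ->
  {within `[0, 1], continuous h} ->
  (forall t, t \in `[0, 1] -> `|df (hmean e x t)| <= h t) ->
  `|F x - F e| <= (x - e) ^+ 2 *
    \int[mu]_(t in `[0, 1]) (t * (t * e + (1 - t) * x) `^ (- 2) * h t).
Proof.
move=> a0 ab eab xab cf cF f' F' ch dfh.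
have e0 : 0 < e by apply: lt_le_trans a0 _; move: eab; rewrite in_itv/= => /andP[].
have x0 : 0 < x by apply: lt_le_trans a0 _; move: xab; rewrite in_itv/= => /andP[].
have [<-|ex] := eqVneq e x; first by rewrite !subrr normr0 expr0n/= mul0r.
have D0 t : t \in `[0, 1] -> 0 < t * e + (1 - t) * x.
  by rewrite in_itv/=; exact: mean_gt0.
have wab t : t \in `]0, 1[ -> hmean e x t \in `]a, b[.
  move=> t01; move: eab xab; rewrite !in_itv/= => /andP[ae eb] /andP[ax xb].
  have [ltex|ltxe|/eqP] := ltgtP e x; last by rewrite (negbTE ex).
  - have := hmean_itv e0 x0 ltex t01; rewrite in_itv/= => /andP[ew wx].
    by rewrite (le_lt_trans ae ew) (lt_le_trans wx xb).
  (* For [x < e] the same curve is traversed backwards. *)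
  - have t01' : 1 - t \in `]0, 1[.
      by move: t01; rewrite !in_itv/= => /andP[t0 t1]; apply/andP; split; lra.
    have := hmean_itv x0 e0 ltxe t01'; rewrite -hmeanC in_itv/= => /andP[xw we].
    by rewrite (le_lt_trans ax xw) (lt_le_trans we eb).
have cw : {within `[0, 1], continuous (hmean e x)}.
  apply: within_continuousM; first exact: within_continuous_cst.
  apply: within_continuousV; first exact: within_continuous_mean.
  by move=> t t01; rewrite gt_eqF// D0.
have wab' t : t \in `[0, 1] -> hmean e x t \in `[a, b].
  rewrite in_itv/= => /andP[]; rewrite le_eqVlt => /predU1P[<- _|t0].
    by rewrite hmean0 ?gt_eqF.
  rewrite le_eqVlt => /predU1P[->|t1]; first by rewrite hmean1 ?gt_eqF.
  by apply: subset_itv_oo_cc; apply: wab; rewrite in_itv/= t0.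
(* [G] equals [F x] at [x] and [F e] at [e], and the terms in [f x - f u] cancel
   in its derivative, leaving only [f']. *)
pose G u := F u - (f x - f u) * (e^-1 - u^-1).
have cG : {within `[a, b], continuous G}.
  apply: within_continuous_sub => //; apply: within_continuousM.
    by apply: within_continuous_sub => //; exact: within_continuous_cst.
  apply: within_continuous_sub; first exact: within_continuous_cst.
  apply: within_continuousV; first exact: within_continuous_idfun.
  by move=> u; rewrite /= in_itv/= => /andP[au _]; rewrite gt_eqF// (lt_le_trans a0).
have G' u : u \in `]a, b[ -> is_derive u 1 G (df u * (e^-1 - u^-1)).
  move=> uab; have u0 : u != 0.
    by move: uab; rewrite in_itv/= => /andP[au _]; rewrite gt_eqF// (lt_trans a0).
  have d1 := is_deriveB (is_derive_cst (f x) u 1) (f' u uab).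
  have d2 := is_deriveB (is_derive_cst e^-1 u 1) 
    (@is_deriveV R id u 1 1 u0 (is_derive_id u 1)).
  apply: (is_derive_eq (is_deriveB (F' u uab) (is_deriveM d1 d2))).
  by rewrite /GRing.scale !fctE /=; field; rewrite u0 gt_eqF.
pose H t := G (hmean e x t).
have -> : F x - F e = H 1 - H 0.
  by rewrite /H hmean1 ?gt_eqF// hmean0 ?gt_eqF// /G !subrr mul0r mulr0 !subr0.
rewrite -RintegralZl//=; last first.
  apply: within_continuous_integrable; apply: within_continuousM => //.
  apply: within_continuousM; first exact: within_continuous_idfun.
  by apply: within_continuous_powR_gt0 => //; exact: within_continuous_mean.
pose dH t := df (hmean e x t) * (e^-1 - (hmean e x t)^-1) *
  (e * x * (x - e) / (t * e + (1 - t) * x) ^+ 2).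
have H' (t : R) : t \in `]0, 1[ -> is_derive t 1 H (dH t).
  move=> t01; apply: (is_derive1_comp (G' _ (wab t t01))).
  by apply: is_derive_hmean; rewrite gt_eqF// D0//; exact: subset_itv_oo_cc.
apply: (norm_increment_le ltr01 _ _ H').
- exact: (within_continuous_comp_sub cw cG).
- apply: within_continuousM; first exact: within_continuous_cst.
  apply: within_continuousM => //.
  apply: within_continuousM; first exact: within_continuous_idfun.
  by apply: within_continuous_powR_gt0 => //; exact: within_continuous_mean.
- move=> t /subset_itv_oo_cc t01; have Dt := D0 t t01.
  have t0 : 0 <= t by move: t01; rewrite in_itv/= => /andP[].
  rewrite powR_invn ?(ltW Dt)//.
  (* On the curve [1/e - 1/u = t * (x - e) / (e * x)]; the derivative of the curve cancels [e * x]
     and supplies the second factor [x - e], so the weight is nonnegative in either order. *)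
  have -> : dH t = (x - e) ^+ 2 * (t * (t * e + (1 - t) * x) ^- 2) * df (hmean e x t).
    rewrite /dH; move: (df _) => d; rewrite /hmean; field.
    by rewrite ?(gt_eqF Dt) ?(gt_eqF e0) ?(gt_eqF x0).
  have c0 : 0 <= (x - e) ^+ 2 * (t * (t * e + (1 - t) * x) ^- 2).
    by rewrite mulr_ge0 ?sqr_ge0// mulr_ge0// invr_ge0 exprn_ge0// ltW.
  by rewrite normrM ger0_norm// mulrA ler_wpM2l// dfh.
Qed.

End Ostrowski.

(** * Relative differentiability at the ends, and the final assembly *)

Lemma derivable_within_cvg (R : realType) (A : set R) (f : R -> R) (x : R) :
  derivable_within A f x -> f y @[y --> within A (nbhs x)] --> f x.
Proof.
move=> /cvg_ex[l fl].
have h0 : h @[h --> within [set h | A (h + x)] (0 : R)^'] --> (0 : R).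
  by apply: cvg_within_filter; exact: nbhs_dnbhs.
(* The increment is [h] times the difference quotient, so it tends to [0 * l]; the cancellation uses
   that [h] is nonzero in the punctured filter. *)
have f0 : f (h + x) - f x @[h --> within [set h | A (h + x)] 0^'] --> (0 : R).
  rewrite -[X in _ --> X](mul0r l).
  apply: cvg_trans (cvgM h0 fl); apply: near_eq_cvg.
  rewrite near_withinE; apply: filterS (nbhs_dnbhs_neq (0 : R)) => h hn0 _.
  by rewrite /= mulrA mulfV// mul1r.
apply/cvgrPdist_lt => e e0; rewrite near_withinE.
move/cvgrPdist_lt : f0 => /(_ e e0).
rewrite near_withinE /dnbhs near_withinE => fe.
have xx : y - x @[y --> x] --> (0 : R).
  by rewrite -(subrr x); apply: cvgB; [exact: cvg_id|exact: cvg_cst].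
have {}fe : \forall y \near x, y - x != 0 -> A (y - x + x) ->
    `|0 - (f (y - x + x) - f x)| < e by exact: xx _ fe.
near=> y => Ay.
(* The punctured limit says nothing at [y = x], where the bound is trivial. *)
have [->|yx] := eqVneq y x; first by rewrite subrr normr0.
have := near fe y; rewrite subrK sub0r opprB subr_eq0.
by apply.
Unshelve. all: by end_near. Qed.

Theorem theorem4 (R : realType) (s : R) (I : set R) (f : R -> R) (a b q : R)
    (hs : 0 < s <= 1)
    (hI : is_interval I) (hI0 : I `<=` [set x | 0 < x])
    (hf : forall x, I° x -> derivable f x 1)
    (ha : I a) (hb : I b) (hab : a < b)
    (hfab : forall x, x \in `[a, b] -> derivable_within I f x)
    (hf' : (@lebesgue_measure R).-integrable `[a, b]
             (EFin \o derive_within I f))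
    (hq : 1 <= q)
    (hconv : harmonically_s_convex s `[a, b]
               (fun u => `|derive_within I f u| `^ q)) :
  forall x, x \in `[a, b] ->
    `| f x - a * b / (b - a) *
         \int[@lebesgue_measure R]_(u in `[a, b]) (f u / u ^+ 2) |
    <= a * b / (b - a) *
       ((x - a) ^+ 2 *
          (lambda1 a x s q q * `|derive_within I f x| `^ q +
           lambda2 a x s q q * `|derive_within I f a| `^ q) `^ (1 / q) +
        (b - x) ^+ 2 *
          (lambda3 b x s q q * `|derive_within I f x| `^ q +
           lambda4 b x s q q * `|derive_within I f b| `^ q) `^ (1 / q)).
Proof.
move=> x xab.
have a0 : 0 < a := hI0 a ha; have b0 : 0 < b := hI0 b hb.
have [s0 q0] : 0 <= s /\ 0 < q.
  by split; [case/andP: hs => /ltW|exact: lt_le_trans hq].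
have x0 : 0 < x by apply: lt_le_trans a0 _; move: xab; rewrite in_itv/= => /andP[].
have aab : a \in `[a, b] by rewrite in_itv/= lexx ltW.
have bab : b \in `[a, b] by rewrite in_itv/= lexx ltW.
have abI u : u \in `[a, b] -> I u.
  by rewrite in_itv/=; exact: hI.
have abI' u : u \in `]a, b[ -> I° u.
  move=> uab; apply: (@filterS _ _ _ `]a, b[%classic); last exact: near_in_itvoo.
  by move=> v /subset_itv_oo_cc; exact: abI.
have cf : {within `[a, b], continuous f}.
  apply/subspace_continuousP => u uab.
  move=> P /(derivable_within_cvg (hfab u uab)); rewrite /nbhs/= /within/=.
  by apply: filterS => v + vab; apply; exact: abI.
pose df := derive_within I f.
have f' (u : R) : u \in `]a, b[ -> is_derive u 1 f (df u).
  move=> uab; split; first exact/hf/abI'.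
  by rewrite /df derive_within_interior ?derive1E//; exact: abI'.
have cg : {within `[a, b], continuous (fun u => f u / u ^+ 2)}.
  apply: within_continuousM => //; apply: within_continuousV.
    apply: within_continuousM; exact: within_continuous_idfun.
  move=> u; rewrite /= in_itv/= => /andP[au _].
  by rewrite expf_neq0// gt_eqF// (lt_le_trans a0).
(* [F' u = (f x - f u) / u ^ 2] and [F b - F a] is the left-hand side up to the
   factor [a b / (b - a)]. *)
pose F u := f x * (a^-1 - u^-1) -
  \int[@lebesgue_measure R]_(t in `[a, u]) (f t / t ^+ 2).
have cF : {within `[a, b], continuous F}.
  apply: within_continuous_sub; last exact: within_continuous_Rintegral (ltW hab) cg.
  apply: within_continuousM; first exact: within_continuous_cst.
  apply: within_continuous_sub; first exact: within_continuous_cst.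
  apply: within_continuousV; first exact: within_continuous_idfun.
  by move=> u; rewrite /= in_itv/= => /andP[au _]; rewrite gt_eqF// (lt_le_trans a0).
have F' (u : R) : u \in `]a, b[ -> is_derive u 1 F ((f x - f u) / u ^+ 2).
  move=> uab; have u0 : u != 0.
    by move: uab; rewrite in_itv/= => /andP[au _]; rewrite gt_eqF// (lt_trans a0).
  have dV := is_deriveB (is_derive_cst a^-1 u 1)
    (@is_deriveV R id u 1 1 u0 (is_derive_id u 1)).
  have dI := is_derive_Rintegral cg uab.
  apply: (is_derive_eq (is_deriveB (is_deriveZ (f x) dV) dI)).
  by rewrite /GRing.scale /=; field.
(* A single estimate, used at [e = a] and at [e = b]. *)
have side e : e \in `[a, b] -> `|F x - F e| <= (x - e) ^+ 2 *
    (euler_integral (q + s) 0 (2 * q) e x * `|df x| `^ q +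
     euler_integral q s (2 * q) e x * `|df e| `^ q) `^ (1 / q).
  move=> eab.
  have e0 : 0 < e by apply: lt_le_trans a0 _; move: eab; rewrite in_itv/= => /andP[].
  apply: le_trans (ler_wpM2l (sqr_ge0 _)
    (Rintegral_convex_bound_le s0 hq (powR_ge0 _ _) (powR_ge0 _ _) e0 x0)).
  apply: (derive_bound_increment a0 hab eab xab cf cF f' F').
    by apply: within_continuous_convex_bound => //; exact: powR_ge0.
  (* Convexity is applied to the ordered pair [e], [x], so that [t ^ s] weights the value at [x];
     taking the power [1 / q] recovers the norm of [df]. *)
  move=> t; rewrite in_itv/= => t01; have := hconv e x t eab xab t01.
  rewrite -/df -/(hmean e x t) => /(ge0_ler_powR (r := 1 / q)).
  rewrite !nnegrE -powRrM mulrCA mulfV ?gt_eqF// mulr1 powRr1//; apply.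
  - by rewrite divr_ge0// ltW.
  - exact: powR_ge0.
  - by rewrite addr_ge0// mulr_ge0 ?powR_ge0.
have Fa : F a = 0 by rewrite /F subrr mulr0 set_itv1 Rintegral_set1 subr0.
have ab0 : 0 < b - a by rewrite subr_gt0.
set J := Rintegral _ _ _.
(* Since [1/a - 1/b = (b - a) / (a * b)], the prefactor turns the coefficient of [f x] in [F b] into
   [1]. *)
have -> : f x - a * b / (b - a) * J = a * b / (b - a) * (F b - F a).
  rewrite Fa /F -/J; field.
  by rewrite ?(gt_eqF a0) ?(gt_eqF b0) ?(gt_eqF ab0).
rewrite normrM ger0_norm; last by rewrite divr_ge0 ?mulr_ge0// ltW.
rewrite ler_pM2l; last by rewrite divr_gt0// mulr_gt0.
rewrite lambda1E ?(ltW q0)// lambda2E ?(ltW q0)//.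
rewrite lambda3E ?(ltW q0)// lambda4E ?(ltW q0)//.
have -> : F b - F a = (F x - F a) - (F x - F b) by ring.
apply: le_trans (ler_normB _ _) _; apply: lerD; first exact: side.
by rewrite -(sqrrN (b - x)) (opprB b x); exact: side.
Qed.
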